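(* There exists a permutation array $P\subset[3]^9$ which is not realized by any nine complete flags in $K^3$, for any field $K$.
   Context: A complete flag in $K^n$ is a chain $E_\bullet=\{0=E_0\subset E_1\subset\cdots\subset E_n=K^n\}$ with $\dim E_i=i$. Let $[n]=\{1,\dots,n\}$. For $x,y\in[n]^d$ write $x\preceq y$ if $x_i\le y_i$ for all $i$; $\bigvee R$ is the coordinatewise maximum of a set $R$. A dot array is a subset $P\subset[n]^d$; $P[y]=\{x\in P:x\preceq y\}$. Put $\mathrm{rk}_jP=\#\{k\in[n]:\exists x\in P,\ x_j=k\}$. $P$ is rankable of rank $r$, written $\mathrm{rk}\,P=r$, if $\mathrm{rk}_jP=r$ for all $j$; it is totally rankable if every $P[y]$ is rankable. A position $x$ is redundant in $P$ if there is $R\subset P$ with $x=\bigvee R$, $\#R>1$, and every $y\in R$ has some coordinate $y_i=x_i$. A permutation array in $[n]^d$ is a totally rankable dot array of rank $n$ no element of which is redundant. A permutation array $P\subset[n]^d$ is realized over $K$ by complete flags $E^1_\bullet,\dots,E^d_\bullet$ in $K^n$ if $\dim(E^1_{x_1}\cap\cdots\cap E^d_{x_d})=\mathrm{rk}\,P[x]$ for all $x\in[n]^d$. *)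

(* Defs.v *)
From HB Require Import structures.
From mathcomp Require Import all_boot all_order all_algebra.

Set Implicit Arguments.
Unset Strict Implicit.
Unset Printing Implicit Defensive.

Import GRing.Theory.

(* [n]^d, with [n] = {1, ..., n} encoded 0-based: k : 'I_n stands for k + 1. *)
Definition position (n d : nat) := {ffun 'I_d -> 'I_n}.

Definition dot_array (n d : nat) := {set {ffun 'I_d -> 'I_n}}.

Section DotArrays.
Variables n d : nat.
Implicit Types (x y : position n d) (P R : dot_array n d).

Definition prec x y : bool := [forall i, (x i <= y i)%N].

Definition below P y : dot_array n d := [set x in P | prec x y].

Definition rk_ (j : 'I_d) P : nat := #|[set (x : position n d) j | x in P]|.

(* P is rankable of rank r. *)
Definition has_rank P (r : nat) : Prop := forall j, rk_ j P = r.

Definition rankable P : Prop := exists r, has_rank P r.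

Definition totally_rankable P : Prop := forall y, rankable (below P y).

(* x is the coordinatewise maximum of R. On the empty set, \max is 0, i.e. the
   first element of [n]; the only use below has #|R| > 1. *)
Definition is_join x R : Prop :=
  forall i, nat_of_ord (x i) = \max_(y in R) nat_of_ord ((y : position n d) i).

Definition redundant P x : Prop :=
  exists R : dot_array n d,
    [/\ R \subset P, is_join x R, (1 < #|R|)%N
      & forall y, y \in R -> exists i, y i = x i].

Definition permutation_array P : Prop :=
  [/\ totally_rankable P, has_rank P n & forall x, x \in P -> ~ redundant P x].

End DotArrays.

Definition complete_flag (K : fieldType) (n : nat)
    (E : 'I_n.+1 -> {vspace 'rV[K]_n}) : Prop :=
  [/\ E ord0 = 0%VS, E ord_max = fullv,
      forall i j : 'I_n.+1, (i <= j)%N -> (E i <= E j)%VS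
    & forall i : 'I_n.+1, \dim (E i) = i].

(* lift ord0 (x j) : 'I_n.+1 has value x j + 1, undoing the 0-based encoding
   of [n]. The equation dim (...) = rk P[x] is read as: P[x] is rankable, of
   rank dim (...). *)
Definition realized_by (K : fieldType) (n d : nat) (P : dot_array n d)
    (E : 'I_d -> 'I_n.+1 -> {vspace 'rV[K]_n}) : Prop :=
  forall x : position n d,
    has_rank (below P x) (\dim (\bigcap_(j < d) E j (lift ord0 (x j)))%VS).

(* Main.v *)
Require Import Defs.
From HB Require Import structures.
From mathcomp Require Import all_boot all_order all_algebra.
From mathcomp Require Import ring.

(** Every finite linear space (a set of points with lines such that two
    distinct points lie on exactly one line) on d > 1 points yields a
    permutation array in [[3]^d] ([linear_space_array_permutation]). The d
    points of the linear space play the role of the planes E^j_2 of the flags,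
    that is, of points of the dual projective plane, and its lines play the role
    of the vectors common to several of these planes; the lines E^j_1 of the
    flags are placed in general position. Nothing in the combinatorial axioms
    distinguishes incidence theorems of projective geometry from their
    failure.

    If complete flags over a field K realize this array, and E^j_2 is the kernel
    of the linear form u_j, then for i != j the vanishing of det (u_i, u_j, u_k)
    says that the three planes share a nonzero vector, which by the rank
    condition means that i, j, k lie on a common line of the linear space
    ([realization_forms]). So the u_j represent the linear space by points of
    a projective plane over K.

    The linear space used here is the non-Pappus configuration on nine points
    a_i, b_j, c_k with i, j, k in Z/3: its lines are the triples a_i b_j c_k with
    i + j + k = 0, except the triple a_0 b_0 c_0, and all pairs not contained in
    one of these eight triples. Over a field the remaining triple is collinear
    as well ([pappus]): a point q off the sides of the triangle a_0 a_1 a_2 has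
    three Ceva ratios, one for each line a_i q, whose product is 1; b_j and c_k
    have the same ratio at a_i exactly when a_i, b_j, c_k are collinear.
    Comparing the product of all ratios of the b_j with that of all ratios of
    the c_k, eight equalities out of nine imply the ninth. *)

Set Implicit Arguments.
Unset Strict Implicit.
Unset Printing Implicit Defensive.

Import GRing.Theory.

(** * The permutation array of a linear space *)

Section LinearSpaceArray.
Variables (d : nat) (L : {set {set 'I_d}}).

Definition linear_space :=
  (forall B, B \in L -> 1 < #|B|) /\
  (forall i j, i != j -> exists! B, B \in L /\ [/\ i \in B & j \in B]).

(** In zero-based coordinates: a vector common to exactly the planes with index
    in B, and on none of the lines of the flags. *)
Definition line_pos (B : {set 'I_d}) : position 3 d :=
  [ffun j => if j \in B then 1%R else ord_max].

(** The line of the i-th flag, lying in no plane of another flag. *)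
Definition point_pos (i : 'I_d) : position 3 d :=
  [ffun j => if j == i then ord0 else ord_max].

Definition linear_space_array : dot_array 3 d :=
  [set line_pos B | B in L] :|: [set point_pos i | i : 'I_d].

Local Notation P := linear_space_array.

Lemma linear_space_arrayP x :
  reflect ((exists2 B, B \in L & x = line_pos B) \/ exists i, x = point_pos i)
          (x \in P).
Proof.
rewrite in_setU; apply: (iffP orP) => [[/imsetP|/imsetP[i _ ->]]|[xL|[i ->]]].
- by left.
- by right; exists i.
- by left; apply/imsetP.
- by right; apply: imset_f.
Qed.

Lemma prec_line_line B S : prec (line_pos B) (line_pos S) = (S \subset B).
Proof.
apply/forallP/subsetP => [h j jS | h j].
  by move: (h j); rewrite !ffunE jS; case: ifP.
by rewrite !ffunE; case: ifP => // jB; case: ifP => // /h; rewrite jB.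
Qed.

Lemma prec_point_line i S : prec (point_pos i) (line_pos S) = (S \subset [set i]).
Proof.
apply/forallP/subsetP => [h j jS | h j].
  by move: (h j); rewrite !ffunE jS inE; case: ifP.
by rewrite !ffunE; case: eqP => // ji; case: ifP => // /h; rewrite inE => /eqP.
Qed.

Lemma line_pos_neq0 B j : line_pos B j != ord0.
Proof. by rewrite ffunE; case: ifP. Qed.

Lemma prec_line_point B i : prec (line_pos B) (point_pos i) = false.
Proof.
apply/negbTE/forallPn; exists i.
by rewrite [point_pos i i]ffunE eqxx leqn0 line_pos_neq0.
Qed.

Lemma prec_point_point i j : prec (point_pos i) (point_pos j) -> i = j.
Proof. by move=> /forallP/(_ j); rewrite !ffunE eqxx eq_sym; case: eqP. Qed.

Hypothesis linL : linear_space.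

Lemma line_unique i j B B' :
  i != j -> B \in L -> B' \in L -> i \in B -> j \in B -> i \in B' -> j \in B' ->
  B = B'.
Proof.
move=> /linL.2[C [_ uC]] BL B'L iB jB iB' jB'.
by rewrite -(uC B) // -(uC B').
Qed.

(** Two lines of a linear space are never nested, having at least two points,
    and for the same reason no line is contained in a point. *)
Lemma linear_space_array_antichain x y :
  x \in P -> y \in P -> prec x y -> x = y.
Proof.
move=> /linear_space_arrayP[[B BL ->]|[i ->]] /linear_space_arrayP[[C CL ->]|[j ->]].
- rewrite prec_line_line => /subsetP sCB.
  have /card_gt1P[i [j [iC jC ij]]] := linL.1 C CL.
  by rewrite (line_unique ij BL CL) // sCB.
- by rewrite prec_line_point.
- rewrite prec_point_line => /subset_leq_card.
  by rewrite cards1 leqNgt linL.1.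
- by move/prec_point_point ->.
Qed.

(** The elements of a set with join x are below x, so in an antichain such a
    set is at most [[set x]]. *)
Lemma antichain_not_redundant n (Q : dot_array n d) x :
  (forall y, y \in Q -> prec y x -> y = x) -> ~ redundant Q x.
Proof.
move=> antiQ [R [sRQ joinR R_gt1 _]].
suff /subset_leq_card : R \subset [set x] by rewrite cards1 leqNgt R_gt1.
apply/subsetP => y yR; rewrite inE; apply/eqP.
apply: antiQ; first exact: (subsetP sRQ).
apply/forallP => i; rewrite joinR.
by apply: (@leq_bigmax_cond _ (mem R) (fun z : position n d => nat_of_ord (z i))).
Qed.

Lemma rank_card_le1 n (Q : dot_array n d) : #|Q| <= 1 -> has_rank Q #|Q|.
Proof.
move=> Q1 j; rewrite /rk_ card_in_imset // => x y xQ yQ _.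
by apply: (card_le1_eqP Q1).
Qed.

Lemma rankable_below_le1 n (Q : dot_array n d) y x0 :
  (forall x, x \in Q -> prec x y -> x = x0) -> rankable (below Q y).
Proof.
move=> h; exists #|below Q y|; apply: rank_card_le1.
have /subset_leq_card : below Q y \subset [set x0].
  by apply/subsetP => x; rewrite !inE => /andP[xQ /(h _ xQ) ->].
by rewrite cards1.
Qed.

(** Redundancy is excluded by the antichain property. For the ranks, at most one
    element is below y when y has a coordinate 1 (a point) or two coordinates 2
    (the line joining two points). Otherwise y has all coordinates 3, and the
    whole array has rank 3, or a single coordinate 2, at b say: then the lines
    through b and the position of b show the values 1, 2 in coordinate b, and
    2, 3 in every other coordinate j, the value 2 coming from the line through
    b and j. *)
Lemma linear_space_array_permutation : 1 < d -> permutation_array P.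
Proof.
move=> d_gt1.
have other (i : 'I_d) : exists j, j != i.
  have /card_gt1P[j [k [_ _ jk]]] : 1 < #|'I_d| by rewrite card_ord.
  case: (eqVneq j i) jk => [->|]; last by exists j.
  by rewrite eq_sym; exists k.
have lineP i j : i != j -> exists2 B, B \in L & i \in B /\ j \in B.
  by move=> /linL.2[B [[BL [iB jB]] _]]; exists B.
have rank_all : has_rank P 3.
  move=> j; rewrite /rk_ (_ : [set _ _ | _ in _] = setT) ?cardsT ?card_ord //.
  apply/setP => k; rewrite !inE; apply/imsetP.
  have [i ij] := other j; have [B BL [_ jB]] := lineP _ _ ij.
  case: k => [[|[|[|//]]] ltk].
  - exists (point_pos j); first by apply/linear_space_arrayP; right; exists j.
    by rewrite ffunE eqxx; apply/val_inj.
  - exists (line_pos B); first by apply/linear_space_arrayP; left; exists B.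
    by rewrite ffunE jB; apply/val_inj.
  - exists (point_pos i); first by apply/linear_space_arrayP; right; exists i.
    by rewrite ffunE eq_sym (negPf ij); apply/val_inj.
split=> //; last first.
- move=> x xP; apply: antichain_not_redundant => y yP.
  exact: linear_space_array_antichain.
move=> y; case: (pickP (fun i => y i == ord0)) => [i /eqP yi|y_neq0].
  apply: (@rankable_below_le1 _ _ _ (point_pos i)) => _ /linear_space_arrayP[[B _ ->]|[j ->]].
    move=> /forallP/(_ i); rewrite yi leqn0 => /negPn.
    by rewrite -[_ == _]/(_ == ord0) line_pos_neq0.
  by move=> /forallP/(_ i); rewrite yi ffunE; case: eqP => // ->.
(* Without coordinates 1, the position y is given by its coordinates 2. *)
pose S := [set i | y i == 1%R]; have -> : y = line_pos S.
  apply/ffunP => i; rewrite ffunE inE; case: eqP => // yi1.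
  apply/val_inj; move: (y_neq0 i) yi1; case: (y i) => [[|[|[|//]]] ltk] //= _.
  by case; apply/val_inj.
have [S_gt1|] := ltnP 1 #|S|.
  have /card_gt1P[i [j [iS jS ij]]] := S_gt1; have [B BL [iB jB]] := lineP _ _ ij.
  apply: (@rankable_below_le1 _ _ _ (line_pos B)) => _ /linear_space_arrayP[[C CL ->]|[k ->]].
    rewrite prec_line_line => /subsetP sSC.
    by rewrite (line_unique ij CL BL) ?sSC.
  by rewrite prec_point_line => /subset_leq_card; rewrite cards1 leqNgt S_gt1.
rewrite leq_eqVlt ltnS leqn0 cards_eq0 => /orP[/cards1P[b ->]|/eqP->]; last first.
  exists 3; rewrite (_ : below _ _ = P) //; apply/setP => x; rewrite inE.
  case: linear_space_arrayP => //= -[[C _ ->]|[i ->]].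
    by rewrite prec_line_line sub0set.
  by rewrite prec_point_line sub0set.
exists 2 => j.
have [a ab] := other b; have [B BL [aB bB]] := lineP _ _ ab.
have below_b x : x \in below P (line_pos [set b]) ->
    x = point_pos b \/ exists2 C, C \in L & b \in C /\ x = line_pos C.
  rewrite inE => /andP[/linear_space_arrayP[[C CL ->]|[i ->]]].
    by rewrite prec_line_line sub1set; right; exists C.
  by rewrite prec_point_line sub1set inE => /eqP->; left.
have point_b : point_pos b \in below P (line_pos [set b]).
  rewrite inE prec_point_line subxx andbT.
  by apply/linear_space_arrayP; right; exists b.
have line_b C : C \in L -> b \in C -> line_pos C \in below P (line_pos [set b]).
  move=> CL bC; rewrite inE prec_line_line sub1set bC andbT.
  by apply/linear_space_arrayP; left; exists C.
rewrite /rk_; case: (eqVneq j b) => [->|jb].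
  rewrite (_ : imset _ _ = [set ord0; 1%R]) ?cards2 //.
  apply/setP => k; rewrite !inE; apply/imsetP/orP.
    by case=> x /below_b[->|[C _ [bC ->]]] ->; rewrite ffunE ?eqxx ?bC; [left|right].
  case=> /eqP->; first by exists (point_pos b); rewrite // ffunE eqxx.
  by exists (line_pos B); rewrite ?line_b // ffunE bB.
rewrite (_ : imset _ _ = [set 1%R; ord_max]) ?cards2 //.
apply/setP => k; rewrite !inE; apply/imsetP/orP.
  case=> x /below_b[->|[C _ [bC ->]]] ->; rewrite ffunE ?(negPf jb); first by right.
  by case: ifP; [left|right].
case=> /eqP->; last by exists (point_pos b); rewrite // ffunE (negPf jb).
have [C CL [jC bC]] := lineP _ _ jb.
by exists (line_pos C); rewrite ?line_b // ffunE jC.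
Qed.

End LinearSpaceArray.

Local Open Scope ring_scope.

(** * Determinants of three linear forms *)

(** The projection along a hyperplane U has values in a line spanned by some
    w; a coordinate at which w is nonzero turns it into a form with kernel U. *)
Lemma hyperplane_form (K : fieldType) n (U : {vspace 'rV[K]_n.+1}) :
  \dim U = n -> exists u : 'cV[K]_n.+1, forall v, (v \in U) = (v *m u == 0).
Proof.
move=> dimU; pose w := vpick (U^C)%VS; pose g := (\1 - projv U)%VF.
have gE v : g v = v - projv U v by rewrite !lfunE /= !lfunE.
have dimUC : \dim (U^C)%VS = 1%N by rewrite dimv_compl dimU dimvf /dim /= mul1n subSnn.
have w_neq0 : w != 0 by rewrite vpick0 -dimv_eq0 dimUC.
have UCE : (U^C = <[w]>)%VS.
  by apply/eqP; rewrite eq_sym eqEdim -memvE memv_pick dimUC dim_vline w_neq0.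
have /existsP[i wi] : [exists i, w 0 i != 0].
  apply: contraNT w_neq0; rewrite negb_exists => /forallP w0.
  by apply/eqP/rowP => i; rewrite mxE; apply/eqP/negbNE/w0.
exists (col i (lin1_mx g)) => v.
rewrite colE mulmxA -colE mul_rV_lin1 -[X in col i X]/(g v).
have [c gv] : exists c, g v = c *: w.
  by apply/vlineP; rewrite -UCE gE memv_projC.
have -> : (v \in U) = (c == 0).
  have -> : (c == 0) = (g v == 0) by rewrite gv scaler_eq0 (negPf w_neq0) orbF.
  rewrite gE subr_eq0; apply/idP/eqP => [/projv_id //|->].
  exact: memv_proj.
rewrite gv; apply/eqP/eqP => [->|/matrixP/(_ 0 0)].
  by rewrite scale0r; apply/matrixP => k l; rewrite !mxE.
by rewrite !mxE => /eqP; rewrite mulf_eq0 (negPf wi) orbF => /eqP.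
Qed.

Section Bracket.
Variable K : fieldType.
Implicit Types u v w : 'cV[K]_3.

Definition bracket u v w : K := \det (\matrix_(r, c) [tuple u; v; w]`_c r 0).

Lemma bracketE u v w : bracket u v w =
  u 0 0 * (v 1 0 * w 2 0 - v 2 0 * w 1 0)
  - u 1 0 * (v 0 0 * w 2 0 - v 2 0 * w 0 0)
  + u 2 0 * (v 0 0 * w 1 0 - v 1 0 * w 0 0).
Proof.
rewrite /bracket (expand_det_col _ 0) !big_ord_recl big_ord0.
rewrite /cofactor !(expand_det_col _ 0) !big_ord_recl !big_ord0.
rewrite /cofactor !det_mx11 !mxE /=.
(* Entries are indexed by naturals so that the lifted ordinals compute. *)
pose f (x : 'cV[K]_3) k := x (inord k) 0.
have fE (x : 'cV[K]_3) i : x i 0 = f x i by rewrite /f inord_val.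
by rewrite !fE /=; ring.
Qed.

Lemma bracket_eq0P u v w :
  reflect (exists2 x : 'rV[K]_3, x != 0 & [/\ x *m u = 0, x *m v = 0 & x *m w = 0])
          (bracket u v w == 0).
Proof.
pose A : 'M[K]_3 := \matrix_(r, c) [tuple u; v; w]`_c r 0.
have AE (x : 'rV_3) c : (x *m A) 0 c = (x *m [tuple u; v; w]`_c) 0 0.
  by rewrite !mxE; apply: eq_bigr => r _; rewrite mxE.
apply: (iffP (@det0P _ _ A)) => -[x x0] => [xA|[xu xv xw]]; exists x => //.
  have col0 (c : 'I_3) : x *m [tuple u; v; w]`_c = 0 :> 'M_1.
    by apply/matrixP => i j; rewrite !ord1 -AE xA !mxE.
  by split; [exact: col0 0|exact: col0 1|exact: col0 2].
apply/rowP => c; rewrite AE.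
by case: c => [[|[|[|//]]] ltc] /=; rewrite ?xu ?xv ?xw !mxE.
Qed.

End Bracket.

(** * Pappus' theorem by Ceva ratios *)

Section Pappus.
Variables (K : fieldType) (a b c : 'I_3 -> 'cV[K]_3).

(** The barycentric coordinate of q opposite to a_(i + 2), up to a factor
    independent of q; it vanishes when q is on the side a_i a_(i + 1). *)
Definition side i q : K := bracket (a i) (a (i + 1)) q.

Definition off_sides q := forall i, side i q != 0.

(** The slope of the line a_i q in barycentric coordinates; note that
    i + 2 = i - 1, so that both sides involved contain a_i. *)
Definition ceva_ratio i q : K := side i q / side (i + 2) q.

(** The easy half of Ceva's theorem: the product telescopes cyclically. *)
Lemma prod_ceva_ratio q : off_sides q -> \prod_i ceva_ratio i q = 1.
Proof.
move=> q_off; rewrite big_split /= prodfV [X in X / _](reindex_inj (addIr 2)).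
by rewrite divff //; apply/prodf_neq0 => i _; apply: q_off.
Qed.

Hypothesis a_free : forall i, bracket (a i) (a (i + 1)) (a (i + 2)) != 0.

(** By a Grassmann-Pluecker relation, the cross-multiplied difference of the two
    ratios is, up to sign, the determinant of a_i, q, r times that of the
    triangle. *)
Lemma ceva_ratio_collinear i q r : off_sides q -> off_sides r ->
  (bracket (a i) q r == 0) = (ceva_ratio i q == ceva_ratio i r).
Proof.
move=> q_off r_off; rewrite /ceva_ratio eqr_div ?q_off ?r_off // /side.
have -> : i + 2 + 1 = i by rewrite -addrA -[RHS]addr0; congr (_ + _); apply/val_inj.
rewrite -[RHS]subr_eq0.
rewrite (_ : _ - _ = - (bracket (a i) q r * bracket (a i) (a (i + 1)) (a (i + 2)))).
  by rewrite oppr_eq0 mulf_eq0 (negPf (a_free i)) orbF.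
by rewrite !bracketE; ring.
Qed.

(** For fixed i the map j |-> - (i + j) is a permutation of Z/3, so the array of
    ratios of the c_k reindexed along the nine triples also has product 1. *)
Lemma pappus : (forall j, off_sides (b j)) -> (forall k, off_sides (c k)) ->
  (forall i j, (i, j) != (0, 0) -> bracket (a i) (b j) (c (- (i + j))) = 0) ->
  bracket (a 0) (b 0) (c 0) = 0.
Proof.
move=> b_off c_off abc; apply/eqP; rewrite ceva_ratio_collinear //; apply/eqP.
pose rb (p : 'I_3 * 'I_3) := ceva_ratio p.1 (b p.2).
pose rc (p : 'I_3 * 'I_3) := ceva_ratio p.1 (c (- (p.1 + p.2))).
have rb1 : \prod_p rb p = 1.
  rewrite -(pair_bigA _ (fun i j => ceva_ratio i (b j))) exchange_big /= big1 // => j _.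
  exact: prod_ceva_ratio.
have rc1 : \prod_p rc p = 1.
  rewrite -(pair_bigA _ (fun i j => ceva_ratio i (c (- (i + j))))) /=.
  rewrite (eq_bigr (fun i => \prod_k ceva_ratio i (c k))) => [|i _].
    by rewrite exchange_big big1 // => k _; apply: prod_ceva_ratio.
  by rewrite [RHS](reindex_inj (inj_comp oppr_inj (addrI i))).
have rbc p : p != (0, 0) -> rb p = rc p.
  by case: p => i j ij0; apply/eqP; rewrite -ceva_ratio_collinear // abc.
have : \prod_p rb p = \prod_p rc p by rewrite rb1 rc1.
rewrite (bigD1 (0, 0)) //= [in RHS](bigD1 (0, 0)) //=.
rewrite (eq_bigr rc) // /rb /rc /= addr0 oppr0 => /mulIf -> //.
by apply/prodf_neq0 => p _; rewrite /rc mulf_neq0 ?invr_eq0 ?c_off.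
Qed.

End Pappus.

(** * Realizations represent the linear space *)

Section Realization.
Variables (d : nat) (L : {set {set 'I_d}}).
Variables (K : fieldType) (E : 'I_d -> 'I_4 -> {vspace 'rV[K]_3}).

Lemma rk_eq0 n (Q : dot_array n d) (j : 'I_d) : (rk_ j Q == 0%N) = (Q == set0).
Proof. by rewrite cards_eq0 imset_eq0. Qed.

Lemma below_line_pos_eq0 (S : {set 'I_d}) : (1 < #|S|)%N ->
  (below (linear_space_array L) (line_pos S) == set0) = ~~ [exists B in L, S \subset B].
Proof.
move=> S_gt1; apply/eqP/existsPn => [Q0 B|noB].
  apply/andP => -[BL sSB].
  have : line_pos B \in below (linear_space_array L) (line_pos S).
    rewrite inE prec_line_line sSB andbT.
    by apply/linear_space_arrayP; left; exists B.
  by rewrite Q0 inE.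
apply/setP => x; rewrite inE in_set0; apply/negP.
case/andP=> /linear_space_arrayP[[B BL ->]|[i ->]].
  by rewrite prec_line_line => sSB; have := noB B; rewrite BL sSB.
by rewrite prec_point_line => /subset_leq_card; rewrite cards1 leqNgt S_gt1.
Qed.

Hypothesis flagE : forall j, complete_flag (E j).
Hypothesis realE : realized_by (linear_space_array L) E.

(** A coordinate 3 of a position imposes no condition, E^j_3 being everything. *)
Lemma mem_bigcap_line_pos S v :
  (v \in \bigcap_(j < d) E j (lift ord0 (line_pos S j)))%VS
  = [forall j in S, v \in E j (lift ord0 1)].
Proof.
apply/idP/forall_inP => [vE j jS|vE].
  by have /subv_bigcapP/(_ j isT) := vE; rewrite ffunE jS.
apply/subv_bigcapP => j _; rewrite ffunE; case: ifP => [/vE //|_].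
rewrite (_ : lift _ _ = ord_max); last exact/val_inj.
by have [_ -> _ _] := flagE j; rewrite subvf.
Qed.

(** The hypothesis i != j makes the index set S below have at least two
    elements, so that only positions of lines can be below that of S; k may
    coincide with i or j. *)
Lemma realization_forms : exists u : 'I_d -> 'cV[K]_3,
  forall i j k, i != j ->
    (bracket (u i) (u j) (u k) == 0)
    = [exists B in L, [&& i \in B, j \in B & k \in B]].
Proof.
have [u uE] : exists u : 'I_d -> 'cV[K]_3,
    forall j v, (v \in E j (lift ord0 1)) = (v *m u j == 0).
  apply: (@fin_all_exists _ (fun=> 'cV[K]_3)
    (fun j w => forall v, (v \in E j (lift ord0 1)) = (v *m w == 0))) => j.
  by apply: hyperplane_form; have [_ _ _ ->] := flagE j.
exists u => i j k ij; pose S := [set i; j; k].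
have S_gt1 : (1 < #|S|)%N by apply/card_gt1P; exists i, j; rewrite !inE !eqxx !orbT.
have -> : [exists B in L, [&& i \in B, j \in B & k \in B]] = [exists B in L, S \subset B].
  by apply: eq_existsb => B; rewrite !subUset !sub1set -!andbA.
rewrite -[RHS]negbK -(below_line_pos_eq0 S_gt1) -(rk_eq0 _ i) realE dimv_eq0.
rewrite -vpick0.
apply/bracket_eq0P/idP => [[v v0 [vi vj vk]]|w0].
  rewrite vpick0; apply: contraNneq v0 => cap0.
  rewrite -memv0 -cap0 mem_bigcap_line_pos; apply/forall_inP => l.
  by rewrite !inE uE => /orP[/orP[]|] /eqP->; apply/eqP.
exists (vpick (\bigcap_(j < d) E j (lift ord0 (line_pos S j)))%VS) => //.
have := memv_pick (\bigcap_(j < d) E j (lift ord0 (line_pos S j)))%VS.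
rewrite mem_bigcap_line_pos => /forall_inP h.
by split; apply/eqP; rewrite -uE; apply: h; rewrite !inE eqxx ?orbT.
Qed.

End Realization.

(** * The non-Pappus linear space *)

Section ListedLinearSpace.
Variable n : nat.
Implicit Types (s : seq nat) (ls : seq (seq nat)).
Local Open Scope nat_scope.

Definition line_set s : {set 'I_n} := [set i | val i \in s].

Definition lines_of ls : {set {set 'I_n}} := [set:: map line_set ls].

(** Finite sets do not compute well, so the axioms of a linear space are tested
    on lines listed as sequences of natural numbers. *)
Definition linear_check ls : bool :=
  all (fun s => 1 < count (mem s) (iota 0 n)) ls &&
  all (fun i => all (fun j => (i == j) ||
    (count (fun s => (i \in s) && (j \in s)) ls == 1)) (iota 0 n)) (iota 0 n).

Definition collinear ls (i j k : nat) : bool :=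
  has (fun s => [&& i \in s, j \in s & k \in s]) ls.

Lemma lines_ofP ls B :
  reflect (exists2 s, s \in ls & B = line_set s) (B \in lines_of ls).
Proof. by rewrite inE; apply: mapP. Qed.

Lemma card_line_set s : #|line_set s| = count (mem s) (iota 0 n).
Proof. by rewrite cardsE cardE size_filter -val_enum_ord count_map -enumT. Qed.

Lemma linear_check_correct ls : linear_check ls -> linear_space (lines_of ls).
Proof.
move=> /andP[/allP ls_gt1 /allP ls1]; split=> [B /lines_ofP[s sL ->]|i j ij].
  by rewrite card_line_set; apply: ls_gt1.
have iI (k : 'I_n) : val k \in iota 0 n by rewrite mem_iota ltn_ord.
have /allP/(_ _ (iI j)) := ls1 _ (iI i).
rewrite (negPf (ij : val i != val j)) /= -size_filter.
set l := filter _ _ => l1.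
have lE s : (s \in l) = [&& s \in ls, val i \in s & val j \in s].
  by rewrite mem_filter andbC.
case: l l1 lE => [|s [|//]] // _ lE.
have := lE s; rewrite mem_head => /esym/and3P[sL si sj].
exists (line_set s); split=> [|B [/lines_ofP[t tL ->]]].
  by rewrite !inE; split=> //; apply: map_f.
by rewrite !inE => -[ti tj]; have := lE t; rewrite tL ti tj inE => /eqP->.
Qed.

Lemma collinearE ls (i j k : 'I_n) :
  [exists B in lines_of ls, [&& i \in B, j \in B & k \in B]] = collinear ls i j k.
Proof.
apply/exists_inP/hasP => [[B /lines_ofP[s sL ->]]|[s sL ijk]].
  by rewrite !inE; exists s.
by exists (line_set s); rewrite ?inE //; apply: map_f.
Qed.

End ListedLinearSpace.

Section NonPappus.
Local Open Scope nat_scope.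

(** The point a_i is encoded as i, b_j as 3 + j and c_k as 6 + k; the dividend
    6 - p.1 - p.2 is nonnegative and congruent to - (p.1 + p.2) modulo 3. *)
Definition non_pappus_triples : seq (seq nat) :=
  [seq [:: p.1; 3 + p.2; 6 + (6 - p.1 - p.2) %% 3]
    | p <- allpairs pair (iota 0 3) (iota 0 3) & p != (0, 0)].

Definition non_pappus_lines : seq (seq nat) :=
  non_pappus_triples ++
  [seq [:: p.1; p.2] | p <- allpairs pair (iota 0 9) (iota 0 9) &
     (p.1 < p.2) && ~~ collinear non_pappus_triples p.1 p.2 p.2].

Definition non_pappus : {set {set 'I_9}} := lines_of 9 non_pappus_lines.

Lemma non_pappus_linear_space : linear_space non_pappus.
Proof. by apply: linear_check_correct; vm_compute. Qed.

End NonPappus.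

(** * Nonrealizability *)

Theorem mainTheorem6 :
  exists P : dot_array 3 9,
    permutation_array P /\
    forall (K : fieldType) (E : 'I_9 -> 'I_4 -> {vspace 'rV[K]_3}),
      (forall j : 'I_9, complete_flag (E j)) -> ~ realized_by P E.
Proof.
exists (linear_space_array non_pappus); split.
  exact: linear_space_array_permutation non_pappus_linear_space _.
move=> K E flagE realE; have [u uE] := realization_forms flagE realE.
have uN m1 m2 m3 : (m1 < 9)%N -> (m2 < 9)%N -> (m3 < 9)%N -> m1 != m2 ->
    (bracket (u (inord m1)) (u (inord m2)) (u (inord m3)) == 0)
    = collinear non_pappus_lines m1 m2 m3.
  by move=> lt1 lt2 lt3 ne; rewrite uE ?collinearE ?inordK // -val_eqE /= !inordK.
pose a (i : 'I_3) := u (inord i); pose b (i : 'I_3) := u (inord (3 + i)).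
pose c (i : 'I_3) := u (inord (6 + i)).
have : bracket (a 0) (b 0) (c 0) == 0.
  rewrite (@pappus _ a) //.
  - by case=> [[|[|[|//]]] lti]; rewrite uN.
  - by move=> [[|[|[|//]]] ltj] [[|[|[|//]]] lti]; rewrite /side uN.
  - by move=> [[|[|[|//]]] ltj] [[|[|[|//]]] lti]; rewrite /side uN.
  - by move=> [[|[|[|//]]] lti] [[|[|[|//]]] ltj] // _; apply/eqP; rewrite uN.
by rewrite uN.
Qed.
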